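(* Let $n\ge 2$. The flag matrix $\mathfrak{M}_n$ (defined in the context) encodes all the possible spectral decompositions of Hermitian operators acting on $\mathbb{C}^n$: for every Hermitian operator $H$ on $\mathbb{C}^n$, whatever the multiplicities of its eigenvalues, a unitary matrix describing its spectral decomposition, i.e. a unitary $A$ with columns $u_1,\dots,u_n$ such that $H=\sum_{i=1}^n\lambda_iu_iu_i^*$ with $\lambda_1,\dots,\lambda_n$ the eigenvalues of $H$ repeated according to multiplicity, can be obtained from $\mathfrak{M}_n$ by properly restricting the parameters entering $\mathfrak{M}_n$.
   Context: $^*$ is the conjugate transpose. For $m\ge 1$, phases $\varphi_1,\dots,\varphi_m\in[0,2\pi)$ and angles $\theta_1,\dots,\theta_{m-1}\in[0,\pi/2]$ put $$y_m=(e^{i\varphi_1}\cos\theta_1,\ e^{i\varphi_2}\sin\theta_1\cos\theta_2,\ \dots,\ e^{i\varphi_{m-1}}\sin\theta_1\cdots\sin\theta_{m-2}\cos\theta_{m-1},\ e^{i\varphi_m}\sin\theta_1\cdots\sin\theta_{m-1})^t,$$ and let $B_m\in U(m)$ be the matrix generated by $y_m$, i.e. the matrix with columns $v_1=y_m$ and $v_{j+1}=\left.\frac{\partial v_1}{\partial\theta_j}\right|_{\theta_1=\dots=\theta_{j-1}=\pi/2}$, $j=1,\dots,m-1$ (first differentiate, then restrict). Put $B_{n-k}^k=\begin{pmatrix} I_k&0\\0&B_{n-k}\end{pmatrix}$. The flag matrix is $$\mathfrak{M}_n=B_n^0\cdot B_{n-1}^1\cdots B_2^{n-2},$$ where each $B_m$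 ($m=n,n-1,\dots,2$) has its own independent angles and phases, except that the first phase is fixed: $\varphi_1=0$ for $m=n$ and $\varphi_1=\pi$ for $m=n-1,\dots,2$. Thus $\mathfrak{M}_n$ depends on $n(n-1)$ real parameters. ''Obtained by restricting the parameters'' means that the unitary matrix is the value of $\mathfrak{M}_n$ at parameter values lying in some subset of the full parameter domain (a subset which may depend on the multiplicities). *)

(* Defs.v *)
From mathcomp Require Import all_boot all_order all_algebra.
From mathcomp Require Export spectral complex.
From mathcomp Require Import all_classical all_reals all_analysis.

Set Implicit Arguments.
Unset Strict Implicit.
Unset Printing Implicit Defensive.

Import Order.TTheory GRing.Theory Num.Theory.
Import numFieldNormedType.Exports.
Local Open Scope ring_scope.
Local Open Scope classical_set_scope.
Local Open Scope sesquilinear_scope.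

(* Indices start at 0; a generating vector in C^(m+1) has m angles and m+1
   phases, so that positivity of the dimension is built into the types. *)

Section FlagMatrix.
Variable R : realType.
Local Notation C := R[i].

Definition expi (x : R) : C := (cos x +i* sin x)%C.

(* The last product is [cos (theta i)] for [i < m] and is empty for [i = m]. *)
Definition gen_vector m (phi : 'I_m.+1 -> R) (theta : 'I_m -> R) : 'cV[C]_m.+1 :=
  \col_(i < m.+1)
    (expi (phi i) *
     (\prod_(j < m | (j < i)%N) sin (theta j) *
      \prod_(j < m | j == i :> nat) cos (theta j))%:C%C).

(* R[i] has no normed module structure over R in the library. *)
Definition derive1C (f : R -> C) (x : R) : C :=
  (derive1 (fun t => complex.Re (f t)) x +i* derive1 (fun t => complex.Im (f t)) x)%C.

Definition partial_angle m p (v : ('I_m -> R) -> 'cV[C]_p) (j : 'I_m)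
    (theta : 'I_m -> R) : 'cV[C]_p :=
  \col_i derive1C (fun t => v [eta theta with j |-> t] i 0) (theta j).

Definition restrict_below m (j : 'I_m) (theta : 'I_m -> R) : 'I_m -> R :=
  fun l => if (l < j)%N then pi / 2 else theta l.

(* Column 0 is the generating vector; column [lift ord0 j] is its derivative in
   the angle of index [j], evaluated where all earlier angles equal pi/2. *)
Definition gen_matrix m (phi : 'I_m.+1 -> R) (theta : 'I_m -> R) : 'M[C]_m.+1 :=
  \matrix_(i, c)
    if unlift ord0 c is Some j
    then partial_angle (gen_vector phi) j (restrict_below j theta) i 0
    else gen_vector phi theta i 0.

(* [conform_mx] only serves as a cast: in [flag_matrix] the block matrix has
   size k + (n - k) = n, so the default value [1%:M] is never used. *)
Definition shift_block n k m (B : 'M[C]_m) : 'M[C]_n :=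
  conform_mx 1%:M (block_mx (1%:M : 'M[C]_k) 0 0 B).

(* The factor of index k = 0, .., n-2 is generated by a vector in C^(n-k), which
   has n-k-1 angles and, its first phase being fixed, n-k-1 free phases: this
   makes n(n-1) real parameters in all. *)
Record flag_params n := FlagParams {
  angle : forall k : 'I_n.-1, 'I_(n - k.+1) -> R;
  phase : forall k : 'I_n.-1, 'I_(n - k.+1) -> R
}.

Definition flag_domain n : set (flag_params n) :=
  [set p | forall (k : 'I_n.-1) (j : 'I_(n - k.+1)),
     0 <= angle p j <= pi / 2 /\ 0 <= phase p j < 2 * pi].

Definition with_first_phase m (c : R) (phi : 'I_m -> R) : 'I_m.+1 -> R :=
  fun i => if unlift ord0 i is Some j then phi j else c.

Definition flag_matrix n (p : flag_params n) : 'M[C]_n :=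
  \prod_(k < n.-1)
    shift_block n k
      (gen_matrix (with_first_phase (if k == 0 :> nat then 0 else pi) (phase p (k := k)))
                  (angle p (k := k))).

Definition eigenvalue_listing n (H : 'M[C]_n) (lam : 'I_n -> C) : Prop :=
  char_poly H = \prod_(i < n) ('X - (lam i)%:P).

Definition spectral_decomposition n (H : 'M[C]_n) (lam : 'I_n -> C)
    (A : 'M[C]_n) : Prop :=
  A \is unitarymx /\
  H = \sum_(i < n) lam i *: (col i A *m (col i A)^t*).

Definition multiplicities n (H : 'M[C]_n) (lam : 'I_n -> C) : 'I_n -> nat :=
  fun i => mup (lam i) (char_poly H).

End FlagMatrix.

(* Main.v *)
(** Up to the phases, the matrix generated by y_m is a real orthogonal frame of
    hyperspherical coordinates, hence unitary, and by polar coordinates its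
    first column is, up to a scalar, an arbitrary unit vector.  Peel the columns of a
    unitary U off one at a time: if P is the product of the first k factors and
    the first k columns of V = P^* U are diagonal, then, V being unitary, column
    k of V is (0, w) with w a unit vector of C^(n-k), and the next factor can be
    chosen with first column proportional to w.  After n-1 steps V is unitary
    with n-1 diagonal columns, hence diagonal, so that U = P D.  The unimodular
    diagonal D does not change the projections u_i u_i^*, so the spectral
    theorem for H, with its eigenvectors ordered as prescribed by lam, gives the
    result; the restriction can be the full parameter domain for all
    multiplicities. *)

Require Import Defs.
From mathcomp Require Import all_boot all_order all_algebra.
From mathcomp Require Import all_classical all_reals all_analysis.
From mathcomp Require Import perm.
From mathcomp Require Import ring lra zify.

Import Order.TTheory GRing.Theory Num.Theory.
Local Open Scope ring_scope.
Local Open Scope classical_set_scope.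

Section FlagMatrix.
Set Implicit Arguments.
Unset Strict Implicit.
Unset Printing Implicit Defensive.
Local Open Scope sesquilinear_scope.
Variable R : realType.
Local Notation C := R[i].

(** * Orthonormality of the real hyperspherical frame *)

Section SphericalFrame.
Variables s c : nat -> R.

(* With [s] and [c] the sines and cosines of the angles, [spherical 0] is the
   vector y_m without its phases and [frame a] the column of index [a] of the
   generated matrix without its phases. *)
Definition spherical (j i : nat) : R := (\prod_(j <= l < i) s l) * c i.

Definition frame (a i : nat) : R :=
  if a is j.+1 then
    if (i < j)%N then 0 else if i == j then - s j else c j * spherical j.+1 i
  else spherical 0 i.

Lemma sphericalS (j i : nat) : (j < i)%N -> spherical j i = s j * spherical j.+1 i.
Proof. by move=> ji; rewrite /spherical big_ltn// mulrA. Qed.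

Lemma sphericalM (a j i : nat) : (a <= j <= i)%N ->
  spherical a i = (\prod_(a <= l < j) s l) * spherical j i.
Proof. by case/andP=> aj ji; rewrite /spherical (big_cat_nat aj ji)/= mulrA. Qed.

Hypothesis sc1 : forall l, s l ^+ 2 + c l ^+ 2 = 1.

(** Telescoping: as [s l ^+ 2 + c l ^+ 2 = 1], each summand is the difference of two consecutive
    products of squared sines. *)
Lemma sum_spherical_sqr (j n : nat) : (j <= n)%N ->
  \sum_(j <= i < n) spherical j i ^+ 2 = 1 - \prod_(j <= l < n) s l ^+ 2.
Proof.
move=> jn; have -> : n = (j + (n - j))%N by lia.
elim: (n - j)%N => [|k IH]; first by rewrite addn0 !big_geq// subrr.
rewrite addnS !big_nat_recr ?leq_addr//= IH /spherical exprMn -prodrXl.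
by have := sc1 (j + k); move: (\prod_(_ <= _ < _) _) => P /(canRL (addrK _)) ->; ring.
Qed.

Variable m : nat.
(** Ends the coordinates at index [m]: the leftover product of squared sines vanishes and the tails
    become unit vectors. *)
Hypothesis sm0 : s m = 0.

Lemma sum_spherical_sqr1 (j : nat) : (j <= m)%N ->
  \sum_(j <= i < m.+1) spherical j i ^+ 2 = 1.
Proof.
move=> jm; rewrite sum_spherical_sqr; last by lia.
by rewrite big_nat_recr//= sm0 expr0n mulr0 subr0.
Qed.

(** Column [j.+1] is supported on indices at least [j]; there every earlier column is a multiple of
    the single vector [spherical j]. *)
Lemma frame_tail (a j : nat) : (a <= j)%N ->
  exists x, forall i, (j <= i)%N -> frame a i = x * spherical j i.
Proof.
case: a => [|b] aj /=.
  by exists (\prod_(0 <= l < j) s l) => i ji; rewrite (@sphericalM 0 j) // ji.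
exists (c b * \prod_(b.+1 <= l < j) s l) => i ji.
rewrite ltnNge (leq_trans (ltnW aj) ji)/= gtn_eqF ?(leq_trans aj ji)//.
by rewrite -mulrA (@sphericalM b.+1 j) // aj.
Qed.

(** For [a <= j] and [b = j.+1], index [j] contributes [- x * c j * s j] and the later indices
    [x * s j * c j] times the squared norm 1 of a tail, so they cancel. *)
Lemma frame_orthonormal (a b : nat) : (a <= m)%N -> (b <= m)%N ->
  \sum_(0 <= i < m.+1) frame a i * frame b i = (a == b)%:R.
Proof.
wlog ab : a b / (a <= b)%N.
  move=> W am bm; case: (leqP a b) => [/W->//|/ltnW /W/(_ bm am)].
  by rewrite eq_sym => <-; apply: eq_bigr => i _; rewrite mulrC.
move=> am; case: b ab => [|j] ab bm.
  move: ab; rewrite leqn0 => /eqP ->; rewrite eqxx -(sum_spherical_sqr1 (leq0n m)).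
  by apply: eq_bigr => i _; rewrite expr2.
rewrite (@big_cat_nat _ _ _ j)//=; last by lia.
rewrite big_nat big1 ?add0r; last by move=> i /andP[_ ->]; rewrite mulr0.
rewrite big_ltn ?ltnn ?eqxx; last by lia.
rewrite big_nat; under eq_bigr => i /andP[ji _].
  rewrite ltnNge (ltnW ji)/= gtn_eqF//; over.
rewrite -big_nat; move: ab; rewrite leq_eqVlt => /orP[/eqP ->|aj].
  rewrite eqxx /= ltnn eqxx big_nat; under eq_bigr => i /andP[ji _].
    rewrite ltnNge (ltnW ji)/= gtn_eqF// -expr2 exprMn; over.
  by rewrite -big_nat -mulr_sumr sum_spherical_sqr1// mulr1 -expr2 sqrrN sc1.
have [x xE] := frame_tail (aj : (a <= j)%N).
rewrite xE// {1}/spherical big_geq// mul1r big_nat.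
under eq_bigr => i /andP[ji _].
  rewrite xE ?(ltnW ji)// (sphericalS ji).
  rewrite (_ : _ * _ = x * s j * c j * spherical j.+1 i ^+ 2); last by ring.
  over.
rewrite -big_nat -mulr_sumr sum_spherical_sqr1// (ltn_eqF aj).
by rewrite mulr1 mulrN [x * s j * _]mulrAC addNr.
Qed.

End SphericalFrame.

(* Setting the missing last angle to 0 turns the empty cosine factor of the last
   coordinate of y_m into [cos 0 = 1]. *)
Definition extend m (theta : 'I_m -> R) (l : nat) : R :=
  if insub l is Some k then theta k else 0.

Lemma extend_ord m (theta : 'I_m -> R) (k : 'I_m) : extend theta k = theta k.
Proof. by rewrite /extend valK. Qed.

Lemma extend_geq m (theta : 'I_m -> R) (l : nat) : (m <= l)%N -> extend theta l = 0.
Proof. by move=> ml; rewrite /extend insubF// ltnNge ml. Qed.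

(** * Closed form of the generated matrix *)

Local Notation sine theta := (fun l => sin (extend theta l)).
Local Notation cosine theta := (fun l => cos (extend theta l)).

Lemma gen_vectorE m (phi : 'I_m.+1 -> R) (theta : 'I_m -> R) (i : 'I_m.+1) :
  gen_vector phi theta i 0 =
    expi (phi i) * (spherical (sine theta) (cosine theta) 0 i)%:C%C.
Proof.
have im : (i <= m)%N by rewrite -ltnS.
rewrite mxE /spherical big_mkord (big_ord_widen m (sine theta) im).
congr (_ * (_ * _)%:C%C).
  by apply: eq_bigr => j _; rewrite extend_ord.
move: im; rewrite leq_eqVlt => /orP[/eqP im|im].
  rewrite big_pred0 ?extend_geq ?im ?cos0// => j.
  by rewrite ltn_eqF.
rewrite (big_pred1 (Ordinal im))//. by rewrite -extend_ord.
Qed.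

Lemma derive1_cosDsin (k a b x : R) :
  derive1 (fun t => k * (a * cos t + b * sin t)) x = k * (b * cos x - a * sin x).
Proof.
rewrite derive1E.
have [_ <-] : is_derive x 1 (k *: (a *: (@cos R) + b *: (@sin R)))
   (k * (b * cos x - a * sin x)).
  have h := is_deriveZ k
    (is_deriveD (is_deriveZ a (is_derive_cos x)) (is_deriveZ b (is_derive_sin x))).
  apply: (is_derive_eq h).
  by rewrite /GRing.scale/= mulrN addrC.
by [].
Qed.

Lemma extend_with m (theta : 'I_m -> R) (j : 'I_m) (t : R) (l : nat) :
  extend [eta restrict_below j theta with j |-> t] l =
    if l == j then t else if (l < j)%N then pi / 2 else extend theta l.
Proof.
have [lm|ml] := ltnP l m.
  rewrite -[l]/(nat_of_ord (Ordinal lm)) !extend_ord /= /restrict_below.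
  by rewrite -val_eqE.
by rewrite !extend_geq// gtn_eqF ?(leq_trans (ltn_ord j))// ltnNge (leq_trans (ltnW (ltn_ord j))).
Qed.

(** At [pi / 2] sines are 1 and cosines 0, so the entries before [j] vanish and the others are
    linear in [cos t] and [sin t], ready for differentiation. *)
Lemma spherical_restrict m (theta : 'I_m -> R) (j : 'I_m) (t : R) (i : nat) :
  let theta' := [eta restrict_below j theta with j |-> t] in
  spherical (sine theta') (cosine theta') 0 i =
    (i == j)%:R * cos t +
    (if (j < i)%N then spherical (sine theta) (cosine theta) j.+1 i else 0) * sin t.
Proof.
move=> theta'; have below (k : nat) : (k <= j)%N -> \prod_(0 <= l < k) sin (extend theta' l) = 1.
  move=> kj; rewrite big_nat big1// => l /= lk.
  have lj : (l < j)%N by apply: leq_trans kj.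
  by rewrite extend_with ltn_eqF// lj sin_pihalf.
case: (ltngtP i j) => [ij|ji|ij].
- by rewrite /spherical extend_with ltn_eqF// ij cos_pihalf mulr0 !mul0r addr0.
- rewrite (@sphericalM _ _ 0 j)// ?below// ?(ltnW ji)// sphericalS//.
  rewrite extend_with eqxx mul1r mul0r add0r mulrC; congr (_ * _).
  rewrite /spherical extend_with gtn_eqF// ltnNge (ltnW ji)/=; congr (_ * _).
  apply: eq_big_nat => l /andP[jl _].
  by rewrite extend_with gtn_eqF// ltnNge (ltnW jl).
- by rewrite /spherical below ?ij// extend_with eqxx !mul1r mul0r addr0.
Qed.

Lemma gen_matrixE m (phi : 'I_m.+1 -> R) (theta : 'I_m -> R) (i a : 'I_m.+1) :
  gen_matrix phi theta i a =
    expi (phi i) * (frame (sine theta) (cosine theta) a i)%:C%C.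
Proof.
rewrite mxE; case: unliftP => [j|] -> /=; last by rewrite gen_vectorE.
rewrite mxE /restrict_below ltnn /= add0n /frame.
(* Puts the cases of [frame] in the form [b * cos x - a * sin x] produced by the derivative. *)
rewrite (_ : (if (i < j)%N then 0 else _) =
    (if (j < i)%N then spherical (sine theta) (cosine theta) j.+1 i else 0) * cos (theta j) -
    (nat_of_ord i == j)%:R * sin (theta j)); last first.
  rewrite extend_ord; case: (ltngtP i j) => _.
  - by rewrite !mul0r subr0.
  - by rewrite mul0r subr0 mulrC.
  - by rewrite mul0r mul1r sub0r.
rewrite /derive1C.
under [X in derive1 X]eq_fun do
  rewrite gen_vectorE spherical_restrict /expi /= mulr0 subr0.
under [X in (_ +i* derive1 X _)%C]eq_fun do
  rewrite gen_vectorE spherical_restrict /expi /= mulr0 add0r.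
rewrite !derive1_cosDsin /expi /=; apply/eqP; rewrite eq_complex /= !mulr0 subr0 add0r.
by apply/andP; split; exact/eqP.
Qed.

(** * Unitarity of the generated matrices and of the factors *)

Lemma unitarymx_colP n (V : 'M[C]_n) :
  reflect (forall a b, \sum_i (V i a)^* * V i b = (a == b)%:R) (V \is unitarymx).
Proof.
apply: (iffP unitarymxP) => [/mulmx1C /matrixP VV a b|VV].
  have := VV a b; rewrite !mxE => <-.
  by apply: eq_bigr => i _; rewrite !mxE.
apply: mulmx1C; apply/matrixP => a b; rewrite !mxE -VV.
by apply: eq_bigr => i _; rewrite !mxE.
Qed.

Lemma conj_expi (x : R) : (expi x)^* * expi x = 1.
Proof.
rewrite /expi; simpc; apply/eqP; rewrite eq_complex /=.
by rewrite -!expr2 cos2Dsin2 mulrC subrr !eqxx.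
Qed.

(** A phase depends only on the row, so it cancels in the inner product of two columns, leaving
    [frame_orthonormal]. *)
Lemma gen_matrix_unitary m (phi : 'I_m.+1 -> R) (theta : 'I_m -> R) :
  gen_matrix phi theta \is unitarymx.
Proof.
apply/unitarymx_colP => a b.
set s := sine theta; set c := cosine theta.
transitivity ((\sum_(i < m.+1) frame s c a i * frame s c b i)%:C%C : C).
  rewrite rmorph_sum; apply: eq_bigr => i _; rewrite !gen_matrixE -/s -/c rmorphM /=.
  rewrite rmorphM (_ : (_%:C)%C^* = (frame s c a i)%:C%C); last exact: conjc_real.
  by rewrite mulrACA conj_expi mul1r.
rewrite -(big_mkord xpredT (fun i => frame s c a i * frame s c b i)).
have sc1 l : s l ^+ 2 + c l ^+ 2 = 1 by rewrite addrC cos2Dsin2.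
have sm0 : s m = 0 by rewrite /s extend_geq// sin0.
have -> := frame_orthonormal sc1 sm0 (ltn_ord a : (a <= m)%N) (ltn_ord b : (b <= m)%N).
by case: (a == b :> nat) (val_eqE a b) => <-.
Qed.

Lemma shift_block_unitary n k m (B : 'M[C]_m) : n = (k + m)%N ->
  B \is unitarymx -> shift_block n k B \is unitarymx.
Proof.
move=> -> /unitarymxP BB; rewrite /shift_block conform_mx_id.
apply/unitarymxP; rewrite tr_block_mx map_block_mx mulmx_block.
rewrite !trmx0 !map_mx0 trmx1 map_mx1 !mulmx0 !mul0mx mulmx1 BB !add0r.
by rewrite ?add0r ?addr0 -scalar_mx_block.
Qed.

(** * Hyperspherical coordinates of an arbitrary unit vector *)

(* At [t = 0] the junk value [a / t = 0] gives [acos 0 = pi / 2], as needed. *)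
Lemma acos_polar (a t : R) : 0 <= a -> 0 <= t -> a ^+ 2 <= t ^+ 2 ->
  [/\ 0 <= acos (a / t) <= pi / 2, t * cos (acos (a / t)) = a &
      t * sin (acos (a / t)) = Num.sqrt (t ^+ 2 - a ^+ 2)].
Proof.
move=> a0 t0; rewrite ler_sqr ?nnegrE// => at_.
have x0 : 0 <= a / t by rewrite divr_ge0.
have x1 : a / t <= 1.
  have [->|t_neq0] := eqVneq t 0; first by rewrite invr0 mulr0.
  by rewrite ler_pdivrMr ?mul1r// lt0r t_neq0.
have tx : t * (a / t) = a.
  have [t_eq0|t_neq0] := eqVneq t 0; last by rewrite mulrC divfK.
  by move: at_; rewrite t_eq0 mul0r => at_; apply/eqP; rewrite eq_le at_ a0.
have x11 : -1 <= a / t <= 1 by rewrite x1 andbT (le_trans _ x0)// lerN10.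
split.
- rewrite acos_ge0//=; rewrite leNgt; apply/negP => lt_pi.
  have := lt_pi; rewrite -ltr_cos ?in_itv/= ?acos_ge0 ?acos_lepi//.
    by rewrite acosK ?in_itv//= cos_pihalf ltNge x0.
  by rewrite divr_ge0 ?pi_ge0//= ler_piMr ?pi_ge0// invf_le1// ler1n.
- by rewrite acosK ?in_itv.
- rewrite (_ : t ^+ 2 - a ^+ 2 = t ^+ 2 * (1 - (a / t) ^+ 2)).
    by rewrite sqrtrM ?sqr_ge0// sqrtr_sqr ger0_norm// sin_acos.
  by rewrite mulrBr mulr1 -exprMn tx.
Qed.

(** Let [T i] be the norm of the tail from index [i]. The angle [acos (f i / T i)] turns [T i] into
    [f i] by its cosine and into [T i.+1] by its sine; as [T 0 = 1], the first [k] sines multiply to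
    [T k]. *)
Lemma spherical_onto m (r : 'I_m.+1 -> R) :
  (forall i, 0 <= r i) -> \sum_i r i ^+ 2 = 1 ->
  exists2 theta : 'I_m -> R, forall j, 0 <= theta j <= pi / 2 &
    forall i : 'I_m.+1, spherical (sine theta) (cosine theta) 0 i = r i.
Proof.
move=> r0 r1; pose f i := r (inord i).
have f0 i : 0 <= f i by apply: r0.
pose T2 i := \sum_(i <= l < m.+1) f l ^+ 2.
have T2_ge0 i : 0 <= T2 i by apply: sumr_ge0 => l _; rewrite sqr_ge0.
have T2S i : (i <= m)%N -> T2 i = f i ^+ 2 + T2 i.+1 by move=> im; rewrite /T2 big_ltn.
pose T i := Num.sqrt (T2 i).
have polar i (im : (i <= m)%N) :
    [/\ 0 <= acos (f i / T i) <= pi / 2, T i * cos (acos (f i / T i)) = f i &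
      T i * sin (acos (f i / T i)) = T i.+1].
  have T2E : T i ^+ 2 = f i ^+ 2 + T2 i.+1 by rewrite sqr_sqrtr// T2S.
  have [|h1 h2 h3] := @acos_polar (f i) (T i) (f0 i) (sqrtr_ge0 _).
    by rewrite T2E lerDl.
  by split=> //; rewrite h3 T2E addrC addKr.
exists (fun j => acos (f j / T j)) => [j|i].
  by have [] := polar j (ltnW (ltn_ord j)).
set theta := fun j : 'I_m => _.
have thE l : (l < m)%N -> extend theta l = acos (f l / T l).
  by move=> lm; rewrite -[l]/(nat_of_ord (Ordinal lm)) extend_ord.
have prodT k : (k <= m)%N -> \prod_(0 <= l < k) sin (extend theta l) = T k.
  elim: k => [_|k IH km]; last first.
    by rewrite big_nat_recr//= IH ?(ltnW km)// thE//; have [] := polar k (ltnW km).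
  rewrite big_geq// /T /T2 big_mkord.
  by under eq_bigr do rewrite /f inord_val; rewrite r1 sqrtr1.
have im : (i <= m)%N by rewrite -ltnS.
rewrite /spherical prodT// -[in r i](inord_val i) -/(f i).
move: im; rewrite leq_eqVlt => /orP[/eqP ->|im].
  (* The last coordinate has no angle: [cos 0 = 1], and [T m] is [f m] by nonnegativity. *)
  by rewrite extend_geq// cos0 mulr1 /T /T2 big_nat1 sqrtr_sqr ger0_norm.
by rewrite thE//; have [] := polar i (ltnW im).
Qed.

Lemma expi_onto (z : C) : `|z| = 1 -> exists2 x, 0 <= x < 2 * pi & expi x = z.
Proof.
case: z => a b; rewrite normc_def /= => -[] ab1.
have {}ab1 : a ^+ 2 + b ^+ 2 = 1.
  by rewrite -[LHS]sqr_sqrtr ?addr_ge0 ?sqr_ge0// ab1 expr1n.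
have a1 : -1 <= a <= 1.
  rewrite -ler_norml -(@ler_pXn2r _ 2)// ?nnegrE// expr1n.
  by rewrite real_normK ?num_real// -ab1 lerDl sqr_ge0.
have cosa : cos (acos a) = a by rewrite acosK ?in_itv.
have sina : sin (acos a) = `|b|.
  by rewrite sin_acos// -ab1 addrC addKr sqrtr_sqr.
have pi0 := pi_gt0 R.
have [b0|b0] := leP 0 b.
  exists (acos a); last by rewrite /expi cosa sina ger0_norm.
  rewrite acos_ge0//=; apply: le_lt_trans (acos_lepi a1) _; lra.
(* [a = 1] would force [b = 0]; strictness gives [acos a > 0], hence an angle below [2 * pi]. *)
have a_lt1 : -1 <= a < 1.
  case/andP: a1 => -> /=; rewrite le_eqVlt => /orP[/eqP a1|//].
  by move: ab1 b0; rewrite a1 => ?; nra.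
exists (2 * pi - acos a).
  have := acos_gt0 a_lt1; have := acos_lepi a1; lra.
rewrite (_ : 2 * pi - acos a = pi - acos a + pi); last by ring.
rewrite /expi cosDpi sinDpi cosB sinB cospi sinpi cosa sina ltr0_norm//.
by congr (_ +i* _)%C; ring.
Qed.

Lemma norm_expi (x : R) : `|expi x| = 1.
Proof. by apply/eqP; rewrite -sqrp_eq1// normCKC conj_expi. Qed.

(** The scalar [d] is the phase of [w ord0] divided by [expi x0]; the free phases are read off
    relative to [d]. *)
Lemma gen_vector_onto m (x0 : R) (w : 'I_m.+1 -> C) :
  \sum_i (w i)^* * w i = 1 ->
  exists theta : 'I_m -> R, exists phi : 'I_m -> R, exists d : C,
    [/\ forall j, 0 <= theta j <= pi / 2, forall j, 0 <= phi j < 2 * pi &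
      forall i, w i = d * gen_vector (with_first_phase x0 phi) theta i 0].
Proof.
move=> w1; pose r i := complex.Re `|w i|.
have rE i : (r i)%:C%C = `|w i| :> C by rewrite RRe_real// normr_real.
have r_ge0 i : 0 <= r i by rewrite -lecR rE; exact: normr_ge0.
have r1 : \sum_i r i ^+ 2 = 1.
  apply: complexI; transitivity (\sum_i (w i)^* * w i); last by rewrite w1.
  rewrite rmorph_sum; apply: eq_bigr => i _.
  by rewrite rmorphXn/= rE normCKC.
have [theta thP thE] := spherical_onto r_ge0 r1.
(* A zero entry has no phase of its own; the value 1 keeps [u] unimodular. *)
pose u i : C := if w i == 0 then 1 else w i / `|w i|.
have u1 i : `|u i| = 1.
  rewrite /u; case: eqVneq => [_|wi0]; first exact: normr1.
  by rewrite normrM normfV normr_id divff// normr_eq0.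
have wE i : w i = u i * `|w i|.
  by rewrite /u; case: eqVneq => [->|wi0]; rewrite ?normr0 ?mulr0// divfK// normr_eq0.
pose d := u ord0 / expi x0.
have d1 : `|d| = 1 by rewrite normrM normfV norm_expi u1 divr1.
have d0 : d != 0 by rewrite -normr_eq0 d1 oner_neq0.
have x0_neq0 : expi x0 != 0 by rewrite -normr_eq0 norm_expi oner_neq0.
have ph j : exists x, 0 <= x < 2 * pi /\ expi x = u (lift ord0 j) / d.
  have [|x] := expi_onto (z := u (lift ord0 j) / d); last by exists x.
  by rewrite normrM normfV d1 u1 divr1.
have [phi phiP] := fin_all_exists ph.
exists theta, phi, d; split=> [//|j|i]; first by have [] := phiP j.
rewrite gen_vectorE thE rE wE normrM u1 mul1r normr_id mulrA; congr (_ * _).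
rewrite /with_first_phase; case: unliftP => [j|] ->; last by rewrite divfK.
by have [_ ->] := phiP j; rewrite mulrC divfK.
Qed.

(** * Successive diagonalization of the columns *)

Lemma unitarymx_diag_col n (V : 'M[C]_n) (j l : 'I_n) : V \is unitarymx ->
  (forall i, i != j -> V i j = 0) -> (V j j)^* * V j l = (j == l)%:R.
Proof.
move=> /unitarymx_colP VV Vj; rewrite -VV (bigD1 j)//= big1 ?addr0// => i ij.
by rewrite Vj// conjC0 mul0r.
Qed.

(** Column [j] is nonzero at index [j] only, so its orthogonality to column [l] kills [V j l]. *)
Lemma unitarymx_diag_row n (V : 'M[C]_n) (j l : 'I_n) : V \is unitarymx ->
  (forall i, i != j -> V i j = 0) -> j != l -> V j l = 0.
Proof.
move=> uV Vj jl.
have := unitarymx_diag_col j uV Vj; have := unitarymx_diag_col l uV Vj.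
rewrite eqxx (negPf jl) => /eqP; rewrite mulf_eq0 => /orP[/eqP ->|/eqP//].
by rewrite mul0r => /eqP; rewrite eq_sym oner_eq0.
Qed.

Lemma shift_block_gen_matrix_onto k m n (x0 : R) (V : 'M[C]_n) :
  n = (k + m.+1)%N -> V \is unitarymx ->
  (forall i j : 'I_n, (j < k)%N -> i != j -> V i j = 0) ->
  exists theta : 'I_m -> R, exists phi : 'I_m -> R,
    [/\ forall j, 0 <= theta j <= pi / 2, forall j, 0 <= phi j < 2 * pi &
      forall j : 'I_n, (j <= k)%N -> exists d, forall i,
        V i j = d * shift_block n k (gen_matrix (with_first_phase x0 phi) theta) i j].
Proof.
move=> nE; subst n => uV Vk; rewrite /shift_block.
(* The first [k] rows are diagonal as well, so column [k] has all its norm in its tail. *)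
have Vk0 i : V (lshift m.+1 i) (rshift k ord0) = 0.
  apply: unitarymx_diag_row => // [i' ii'|]; last by rewrite eq_lrshift.
  by rewrite Vk//=.
have [|theta [phi [d [thP phiP wE]]]] :=
    @gen_vector_onto m x0 (fun i => V (rshift k i) (rshift k ord0)).
  have /unitarymx_colP/(_ (rshift k ord0) (rshift k ord0)) := uV.
  rewrite eqxx big_split_ord/= big1 ?add0r// => i _.
  by rewrite Vk0 mulr0.
exists theta, phi; split=> // j; rewrite leq_eqVlt conform_mx_id => /orP[/eqP jk|jk].
  have -> : j = rshift k ord0 by apply/val_inj; rewrite /= addn0.
  exists d => i; case: (split_ordP i) => i' ->; rewrite ?block_mxEur ?block_mxEdr.
    by rewrite Vk0 mxE mulr0.
  by rewrite wE; congr (_ * _); rewrite [RHS]mxE unlift_none.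
exists (V j j) => i; have -> : j = lshift m.+1 (Ordinal jk) by apply/val_inj.
have [->|ij] := eqVneq i (lshift m.+1 (Ordinal jk)).
  by rewrite block_mxEul mxE eqxx mulr1.
rewrite Vk//; case: (split_ordP i) ij => i' ->; rewrite ?block_mxEul ?block_mxEdl mxE ?mulr0//.
by rewrite eq_lshift => /negPf ->; rewrite mulr0.
Qed.

(** Column [j] of [S^t* *m V] is [d] times that of [S^t* *m S], the identity. *)
Lemma adjoint_diag_col n (S V : 'M[C]_n) (j : 'I_n) : S \is unitarymx ->
  (exists d, forall i, V i j = d * S i j) ->
  forall i, i != j -> (S^t* *m V) i j = 0.
Proof.
move=> /unitarymx_colP SS [d VE] i ij; rewrite mxE.
transitivity (d * \sum_l (S l i)^* * S l j); last by rewrite SS (negPf ij) mulr0.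
by rewrite mulr_sumr; apply: eq_bigr => l _; rewrite !mxE VE mulrCA.
Qed.

Lemma unitarymx1 n : (1%:M : 'M[C]_n) \is unitarymx.
Proof. by apply/unitarymxP; rewrite trmx1 map_mx1 mulmx1. Qed.

Lemma mul_adjoint_unitarymx n (P U : 'M[C]_n) :
  P \is unitarymx -> U \is unitarymx -> P^t* *m U \is unitarymx.
Proof. by move=> uP uU; apply: mul_unitarymx uU; rewrite trmxC_unitary. Qed.

Definition flag_block n (p : flag_params R n) (k : 'I_n.-1) : 'M[C]_n :=
  shift_block n k
    (gen_matrix (with_first_phase (if k == 0 :> nat then 0 else pi) (phase p (k := k)))
                (angle p (k := k))).

Definition flag_factor n (p : flag_params R n) (l : nat) : 'M[C]_n :=
  if insub l is Some k then flag_block p k else 1%:M.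

Lemma flag_matrix_prod n (p : flag_params R n) :
  flag_matrix p = \prod_(0 <= l < n.-1) flag_factor p l.
Proof.
rewrite big_mkord /flag_matrix; apply: eq_bigr => k _.
by rewrite /flag_factor valK.
Qed.

(** Induction on [k]: only the parameters of the factor of index [k] are redefined, so the prefix
    already built is unchanged. *)
Lemma flag_prefix_onto n (U : 'M[C]_n) (k : nat) : U \is unitarymx -> (k <= n.-1)%N ->
  exists2 p : flag_params R n, flag_domain p &
    let P := \prod_(0 <= l < k) flag_factor p l in
    P \is unitarymx /\
    forall i j : 'I_n, (j < k)%N -> i != j -> (P^t* *m U) i j = 0.
Proof.
move=> uU; elim: k => [_|k IH kn].
  exists (FlagParams (fun _ _ => 0) (fun _ _ => 0)).
    by move=> k j /=; rewrite lexx mulr_gt0 ?pi_gt0// divr_ge0 ?pi_ge0.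
  rewrite big_geq; last by [].
  split; [exact: unitarymx1|by move=> i j; rewrite ltn0].
have [p pD [uP PU]] := IH (ltnW kn).
set P := \prod_(0 <= l < k) _ in uP PU.
(* The block has size [n - k], one more than its [n - k.+1] angles. *)
pose kk := Ordinal kn; have nE : n = (k + (n - k.+1).+1)%N by lia.
have uV : P^t* *m U \is unitarymx by apply: mul_adjoint_unitarymx.
have [theta [phi [thP phiP SV]]] :=
  shift_block_gen_matrix_onto (if k == 0 then 0 else pi) nE uV PU.
pose p' := @FlagParams R n (eqtype.dfwith (@angle R n p) (i := kk) theta)
                           (eqtype.dfwith (@phase R n p) (i := kk) phi).
have p'k : flag_factor p' k =
    shift_block n k (gen_matrix (with_first_phase (if k == 0 then 0 else pi) phi) theta).
  rewrite /flag_factor (_ : insub k = Some kk); last by rewrite -[k]/(val kk) valK.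
  by rewrite /flag_block /= !eqtype.dfwith_in.
have p'l l : (l < k)%N -> flag_factor p' l = flag_factor p l.
  move=> lk; rewrite /flag_factor; case: insubP => // l' _ l'E.
  have kl' : kk != l' by rewrite -val_eqE /= l'E gtn_eqF.
  by rewrite /flag_block /= !eqtype.dfwith_out.
exists p'.
  move=> l j /=; have [kl|kl] := eqVneq kk l; last by rewrite !eqtype.dfwith_out//; exact: pD.
  move: j; rewrite -kl => j; rewrite !eqtype.dfwith_in.
  by split; [exact: thP|exact: phiP].
rewrite big_nat_recr /=; last by [].
rewrite big_nat (eq_bigr (flag_factor p)); last first.
  by move=> l /andP[_ lk]; exact: p'l.
rewrite -big_nat -/P p'k; set S := shift_block _ _ _ in SV *.
have uS : S \is unitarymx by apply: shift_block_unitary => //; exact: gen_matrix_unitary.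
split; [exact: mul_unitarymx uP uS|move=> i j jk ij].
(* The adjoint of [P *m S] applied to [U] is that of [S] applied to [P^t* *m U]. *)
rewrite -mulmxE trmx_mul map_mxM -mulmxA.
by apply: adjoint_diag_col => //; exact: SV.
Qed.

Lemma flag_matrix_onto n (U : 'M[C]_n) : U \is unitarymx ->
  exists2 p : flag_params R n, flag_domain p &
    flag_matrix p \is unitarymx /\
    forall j, exists2 d : C, d * d^* = 1 & col j U = d *: col j (flag_matrix p).
Proof.
move=> uU; have [p pD [uP PU]] := flag_prefix_onto uU (leqnn _).
exists p; first exact: pD.
rewrite flag_matrix_prod; split; [exact: uP|move=> j].
set P := \prod_(0 <= l < _) _ in uP PU *.
have uD : P^t* *m U \is unitarymx by apply: mul_adjoint_unitarymx.
have UE : U = P *m (P^t* *m U) by rewrite mulmxA (unitarymxP uP) mul1mx.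
set D := P^t* *m U in uD PU UE.
clearbody D.
have D0 i l : i != l -> D i l = 0.
  move=> il; have [ln|nl] := ltnP l n.-1; first exact: PU.
  (* Here [l] is the last index, so column [i] is already diagonal, and row [i] with it. *)
  have ilt : (i < n.-1)%N.
    move: il; rewrite -val_eqE /= neq_ltn => /orP[|]; have := ltn_ord l; have := ltn_ord i; lia.
  by apply: unitarymx_diag_row => // i' ii'; apply: PU.
exists (D j j).
  rewrite mulrC; have := unitarymx_diag_col j uD (fun i => @D0 i j).
  by rewrite eqxx.
apply/colP => i; rewrite [in LHS]UE !mxE (bigD1 j)//= big1 ?addr0 1?mulrC// => l lj.
by rewrite D0// mulr0.
Qed.

(** * Spectral theorem with the eigenvalues in a prescribed order *)

Lemma char_poly_conj (F : fieldType) n (P A : 'M[F]_n) : P \in unitmx ->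
  char_poly (invmx P *m A *m P) = char_poly A.
Proof.
move=> uP; rewrite /char_poly /char_poly_mx.
set Q := map_mx polyC P; set Q' := map_mx polyC (invmx P).
have QQ : Q' *m Q = 1%:M by rewrite -map_mxM mulVmx// map_mx1.
have -> : 'X%:M - map_mx polyC (invmx P *m A *m P) =
    Q' *m ('X%:M - map_mx polyC A) *m Q.
  by rewrite !map_mxM mulmxBr mulmxBl scalar_mxC -[_ *m Q' *m Q]mulmxA QQ mulmx1.
by rewrite !det_mulmx mulrAC -det_mulmx QQ det1 mul1r.
Qed.

Lemma prod_XsubC_perm (F : fieldType) n (a b : 'I_n -> F) :
  \prod_(i < n) ('X - (a i)%:P) = \prod_(i < n) ('X - (b i)%:P) ->
  exists s : 'S_n, forall i, a i = b (s i).
Proof.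
move=> ab; have : perm_eq [tuple a i | i < n] [tuple b i | i < n].
  by apply: prod_XsubC_eq; rewrite !big_map -!enumT !big_enum.
case/tuple_permP => s /val_inj abs; exists s => i.
by move: (congr1 (fun t => tnth t i) abs); rewrite !tnth_mktuple.
Qed.

(** Diagonalization lists the eigenvalues in an order of its own; comparing characteristic
    polynomials gives a permutation to [lam], which is applied to the columns of [P^t*]. *)
Lemma hermitian_spectral_listing n (H : 'M[C]_n) (lam : 'I_n -> C) :
  H \is hermsymmx -> eigenvalue_listing H lam ->
  exists2 U : 'M[C]_n, U \is unitarymx &
    H = \sum_(i < n) lam i *: (col i U *m (col i U)^t*).
Proof.
move=> /hermitian_normalmx /orthomx_spectralP.
set P := spectralmx H; set d := spectral_diag H => HE; rewrite /eigenvalue_listing.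
have uP : P \is unitarymx by apply: spectral_unitarymx.
have -> : char_poly H = char_poly (diag_mx d).
  by rewrite HE char_poly_conj// unitarymx_unit.
rewrite char_poly_trig ?diag_mx_is_trig// => /esym.
under [X in _ = X -> _]eq_bigr do rewrite mxE eqxx mulr1n.
case/prod_XsubC_perm => s lamE.
exists (col_perm s (P^t*)).
  have uPt : P^t* \is unitarymx by rewrite trmxC_unitary.
  apply/unitarymx_colP => a b; have /unitarymx_colP/(_ (s a) (s b)) := uPt.
  by rewrite (inj_eq perm_inj) => <-; apply: eq_bigr => i _; rewrite !mxE.
rewrite HE invmx_unitary//; apply/matrixP => a b; rewrite summxE mxE.
rewrite (reindex_perm s)/=; apply: eq_bigr => i _.
rewrite mul_mx_diag !mxE big_ord1 !mxE conjCK lamE.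
by rewrite mulrAC mulrC mulrA.
Qed.

End FlagMatrix.

Theorem corollary3 (R : realType) (n : nat) (n_ge2 : (2 <= n)%N) :
  exists restriction : ('I_n -> nat) -> set (flag_params R n),
    (forall mult, restriction mult `<=` flag_domain (R := R) (n := n)) /\
    (forall (H : 'M[R[i]]_n) (lam : 'I_n -> R[i]),
       H \is hermsymmx ->
       eigenvalue_listing H lam ->
       exists2 p : flag_params R n,
         p \in restriction (multiplicities H lam) &
         spectral_decomposition H lam (flag_matrix p)).
Proof.
exists (fun=> flag_domain (R := R) (n := n)); split=> [mult p //|H lam hH lamH].
have [U uU HE] := hermitian_spectral_listing hH lamH.
have [p pD [uP UP]] := flag_matrix_onto uU.
exists p; first by rewrite inE.
split; first exact: uP.
rewrite {1}HE; apply: eq_bigr => i _; have [d d1 ->] := UP i.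
(* The scalar enters the rank-one projection only through [d * d^* = 1]. *)
congr (_ *: _); move: (col i (flag_matrix p)) => u; apply/matrixP => a b.
by rewrite !mxE !big_ord1 !mxE rmorphM mulrACA d1 mul1r.
Qed.
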